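(* Consider an instance of the Oven Scheduling Problem (OSP). For each attribute $r\in\mathcal{A}=\{1,\dots,a\}$ let $b_r=|J_r^l|+\max(b_r^E,b_r^C)$ and let $b=\sum_{r=1}^a b_r$, where $J_r^l$, $b_r^E$, $b_r^C$ are as defined in the context. Let $\texttt{setup\_costs}$ be the list, sorted in non-decreasing order, consisting of the following $b+k$ elements ($k$ being the number of machines): for every attribute $r$, $b_r$ copies of $\min_{s\in\{1,\dots,a\}}sc(r,s)$; and for every machine $m\in\mathcal{M}$, one element $\min_{s\in\{1,\dots,a\}}sc(s_m,s)$, where $s_m$ is the initial state of $m$. Then the cumulative setup costs $sc$ of any feasible solution satisfy $$sc\ \ge\ \max\left(\sum_{r=1}^a b_r\cdot\min_{s\in\{1,\dots,a\}} sc(s,r),\ \ \sum_{i=1}^{b}\texttt{setup\_costs}(i)\right),$$ where $\texttt{setup\_costs}(i)$ is the $i$-th element of the sorted list.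
   Context: OSP instance. A finite set $\mathcal{M}=\{1,\dots,k\}$ of machines, a finite set $\mathcal{J}=\{1,\dots,n\}$ of jobs, a set $\mathcal{A}=\{1,\dots,a\}$ of attributes, and a scheduling horizon length $l\in\mathbb{N}$. Each machine $m$ has a capacity $c_m$ (a positive integer), an initial state $s_m\in\mathcal{A}$, and $I$ availability intervals $[as(m,i),ae(m,i)]\subseteq[0,l]$, $1\le i\le I$, with $as(m,i)\le ae(m,i)\le as(m,i+1)$. Each job $j$ has a set $\mathcal{E}_j\subseteq\mathcal{M}$ of eligible machines, an earliest start time $et_j\in\mathbb{N}$ with $0\le et_j<l$, a latest end time $lt_j\in\mathbb{N}$ with $et_j<lt_j\le l$, natural numbers $0<mint_j\le maxt_j$ (minimal and maximal processing time), a size $s_j\in\mathbb{N}$, and an attribute $a_j\in\mathcal{A}$. There are $a\times a$ matrices of non-negative integer setup times $st(\cdot,\cdot)$ and setup costs $sc(\cdot,\cdot)$, indexed by ordered pairs of attributes (not necessarily symmetric, not necessarily satisfying the triangle inequality). Feasible solution. Jobs are partitioned into non-empty batches; each batch is assigned to a machine, and the batches on machine $m$ are ordered $B_{m,1},\dots,B_{m,b_m}$ ($b_m$ is the number of batches on $m$). Each batch $B_{m,b}$ has an integer start time $S_{m,b}\in[0,l]$, and its processing time is $P_{m,b}=\max_{j\in B_{m,b}} mint_j$. For every batch $B_{m,b}$ and all $j\in B_{m,b}$: $m\in\mathcal{E}_j$; $S_{m,b}\ge et_j$; $P_{m,b}\le maxt_j$. All jobs in a batch have the same attribute, which is the attribute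 $A_{m,b}$ of the batch. The total size satisfies $\sum_{j\in B_{m,b}}s_j\le c_m$. Consecutive batches satisfy $S_{m,b}+P_{m,b}+st(A_{m,b},A_{m,b+1})\le S_{m,b+1}$. Each batch together with its preceding setup lies within one availability interval: for each $m,b$ there is $i$ with $S_{m,b}+P_{m,b}\le ae(m,i)$ and $as(m,i)\le S_{m,b}-st(A',A_{m,b})$, where $A'=A_{m,b-1}$ if $b\ge2$ and $A'=s_m$ if $b=1$. (Due dates $lt_j$ need not be met.) Cumulative setup costs of a feasible solution: $sc=\sum_{m\in\mathcal{M}:\,b_m\ge1}\Bigl(sc(s_m,A_{m,1})+\sum_{b=1}^{b_m-1}sc(A_{m,b},A_{m,b+1})\Bigr)$. Large and small jobs. $J_r^l=\{j\in\mathcal{J}: a_j=r \text{ and } \max_{m\in\mathcal{E}_j}c_m - s_j<\min_{i\in\mathcal{J}:a_i=r}s_i\}$, and $J_r^s=\{j\in\mathcal{J}:a_j=r\}\setminus J_r^l$. Quantity $b_r^E$. For $i\in\mathcal{M}$ let $b_{r,i}=\frac{1}{c_i}\sum_{j\in J_r^s:\ \mathcal{E}_j=\{i\}}s_j$ and $cap_i=(\lceil b_{r,i}\rceil-b_{r,i})\cdot c_i$. Let $S_r=\sum_{j\in J_r^s:\ |\mathcal{E}_j|>1}s_j$. Then $$b_r^E=\sum_{i\in\mathcal{M}}\lceil b_{r,i}\rceil+\left\lceil\frac{\max\bigl(0,\ S_r-\sum_{i\in\mathcal{M}}cap_i\bigr)}{\max_{m\in\mathcal{M}}c_m}\right\rceil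 .$$ Quantity $b_r^C$. $b_r^C=GACb(J_r^s,\max_{m\in\mathcal{M}}c_m)$, where for a set $J$ of jobs, $GACb(J,c)$ is the number of batches returned by the following Algorithm GAC+ when every job $j\in J$ is replaced by $s_j$ identical unit size copies (with the same $mint_j$, $maxt_j$). Algorithm GAC+: consider the unit size jobs in non-increasing order of $mint_j$, ties broken arbitrarily. Repeatedly, until all jobs are placed, open a new batch, let $j^*$ be the first job in this order not yet placed, and, starting with $j^*$, place into the batch the first $c$ not yet placed jobs $j$ with $mint_{j^*}\in[mint_j,maxt_j]$ (or all of them if there are fewer than $c$). The number of batches does not depend on how ties are broken. *)

(* Defs.v *)
From HB Require Import structures.
From mathcomp Require Import all_boot all_order all_algebra.
Set Implicit Arguments.
Unset Strict Implicit.
Unset Printing Implicit Defensive.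
Import Order.TTheory GRing.Theory Num.Theory.

(* All index sets are 0-based: machines 'I_k, jobs 'I_n, attributes 'I_a,
   availability intervals of a machine 'I_q.  The ends of the availability
   intervals live in an arbitrary ordered domain R, so that they may be
   integers as well as reals; all other data are natural numbers. *)
Record osp_instance (R : realDomainType) (k n a q : nat) := OspInstance {
  horizon    : nat;
  capacity   : 'I_k -> nat;
  init_state : 'I_k -> 'I_a;
  avail_start : 'I_k -> 'I_q -> R;
  avail_end   : 'I_k -> 'I_q -> R;
  eligible   : 'I_n -> {set 'I_k};
  earliest   : 'I_n -> nat;
  latest     : 'I_n -> nat;
  mint       : 'I_n -> nat;
  maxt       : 'I_n -> nat;
  jsize      : 'I_n -> nat;
  jattr      : 'I_n -> 'I_a;
  setup_time : 'I_a -> 'I_a -> nat;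
  setup_cost : 'I_a -> 'I_a -> nat;
  capacity_gt0 : forall m, 0 < capacity m;
  avail_in_horizon : forall m i,
    (0 <= avail_start m i)%R /\ (avail_end m i <= (horizon%:R : R))%R;
  avail_start_le_end : forall m i, (avail_start m i <= avail_end m i)%R;
  avail_end_le_next : forall m (i i' : 'I_q),
    i' = i.+1 :> nat -> (avail_end m i <= avail_start m i')%R;
  earliest_lt_horizon : forall j, earliest j < horizon;
  earliest_lt_latest  : forall j, earliest j < latest j;
  latest_le_horizon   : forall j, latest j <= horizon;
  mint_gt0     : forall j, 0 < mint j;
  mint_le_maxt : forall j, mint j <= maxt j
}.

(* The batches on machine m are those at positions b < nbatch m; the other
   values of bjobs, bstart and battr are irrelevant. *)
Record schedule (k n a : nat) := Schedule {
  nbatch : 'I_k -> nat;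
  bjobs  : 'I_k -> nat -> {set 'I_n};
  bstart : 'I_k -> nat -> nat;
  battr  : 'I_k -> nat -> 'I_a
}.

Section OSP.
Variables (R : realDomainType) (k n a q : nat) (O : osp_instance R k n a q).

Section Schedule.
Variable S : schedule k n a.

Definition ptime (m : 'I_k) (b : nat) : nat := \max_(j in bjobs S m b) mint O j.

Definition prev_attr (m : 'I_k) (b : nat) : 'I_a :=
  if b is b'.+1 then battr S m b' else init_state O m.

Record feasible : Prop := Feasible {
  feas_nonempty : forall m b, b < nbatch S m -> bjobs S m b != set0;
  feas_partition : forall j : 'I_n, exists! p : 'I_k * nat,
    p.2 < nbatch S p.1 /\ j \in bjobs S p.1 p.2;
  feas_start : forall m b, b < nbatch S m -> bstart S m b <= horizon O;
  feas_eligible : forall m b j, b < nbatch S m -> j \in bjobs S m b ->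
    m \in eligible O j;
  feas_earliest : forall m b j, b < nbatch S m -> j \in bjobs S m b ->
    earliest O j <= bstart S m b;
  feas_maxt : forall m b j, b < nbatch S m -> j \in bjobs S m b ->
    ptime m b <= maxt O j;
  feas_attr : forall m b j, b < nbatch S m -> j \in bjobs S m b ->
    jattr O j = battr S m b;
  feas_capacity : forall m b, b < nbatch S m ->
    \sum_(j in bjobs S m b) jsize O j <= capacity O m;
  feas_consecutive : forall m b, b.+1 < nbatch S m ->
    bstart S m b + ptime m b + setup_time O (battr S m b) (battr S m b.+1)
      <= bstart S m b.+1;
  feas_avail : forall m b, b < nbatch S m -> exists i : 'I_q,
    ((bstart S m b + ptime m b)%N%:R <= avail_end O m i)%R /\
    (avail_start O m i <=
       (bstart S m b)%:R - (setup_time O (prev_attr m b) (battr S m b))%:R)%R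
}.

Definition total_setup_cost : nat :=
  \sum_(m | 0 < nbatch S m)
    (setup_cost O (init_state O m) (battr S m 0)
     + \sum_(b < (nbatch S m).-1)
         setup_cost O (battr S m b) (battr S m b.+1)).

End Schedule.

Definition max_capacity : nat := \max_(m < k) capacity O m.

(* In the three minima below, the neutral element of the iterated minn is
   itself one of the values ranged over, so these are plain minima. *)
Definition min_size_like (j : 'I_n) : nat :=
  \big[minn/jsize O j]_(i | jattr O i == jattr O j) jsize O i.

Definition min_cost_from (r : 'I_a) : nat :=
  \big[minn/setup_cost O r r]_(s < a) setup_cost O r s.

Definition min_cost_to (r : 'I_a) : nat :=
  \big[minn/setup_cost O r r]_(s < a) setup_cost O s r.

(* The difference is taken in int, since it may be negative. *)
Definition large_jobs (r : 'I_a) : {set 'I_n} :=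
  [set j | (jattr O j == r) &&
     ((\max_(m in eligible O j) capacity O m)%N%:Z - (jsize O j)%:Z
        < (min_size_like j)%:Z)%R].

Definition small_jobs (r : 'I_a) : {set 'I_n} :=
  [set j | jattr O j == r] :\: large_jobs r.

Definition bE_dedicated (r : 'I_a) (i : 'I_k) : rat :=
  ((\sum_(j in small_jobs r | eligible O j == [set i]) jsize O j)%N%:R
     / (capacity O i)%:R)%R.

Definition bE_cap (r : 'I_a) (i : 'I_k) : rat :=
  (((Num.ceil (bE_dedicated r i))%:~R - bE_dedicated r i)
     * (capacity O i)%:R)%R.

Definition bE_shared (r : 'I_a) : nat :=
  \sum_(j in small_jobs r | 1 < #|eligible O j|) jsize O j.

(* The integer under the absolute value is nonnegative: absz only casts it
   to nat. *)
Definition bE (r : 'I_a) : nat :=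
  `|(\sum_(i < k) Num.ceil (bE_dedicated r i)
     + Num.ceil (Num.max 0 ((bE_shared r)%:R - \sum_(i < k) bE_cap r i)
                 / max_capacity%:R))%R|%N.

(* A unit size copy of a job is represented by the job itself. *)
Definition unit_copies (J : {set 'I_n}) : seq 'I_n :=
  flatten [seq nseq (jsize O j) j | j <- enum J].

(* ord J lists the unit size copies of the jobs of J in the order in which
   GAC+ considers them; ord is thus an arbitrary tie-breaking rule. *)
Definition gac_order (ord : {set 'I_n} -> seq 'I_n) : Prop :=
  forall J : {set 'I_n}, perm_eq (ord J) (unit_copies J) /\
    sorted (fun i j => mint O j <= mint O i) (ord J).

(* (the first c elements of s satisfying p, the remaining elements of s) *)
Fixpoint split_first (p : pred 'I_n) (c : nat) (s : seq 'I_n) :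
    seq 'I_n * seq 'I_n :=
  if s is x :: s' then
    if p x && (0 < c) then
      let: (t, u) := split_first p c.-1 s' in (x :: t, u)
    else let: (t, u) := split_first p c s' in (t, x :: u)
  else ([::], [::]).

Definition gac_compatible (j0 j : 'I_n) : bool :=
  mint O j <= mint O j0 <= maxt O j.

(* For c > 0 every batch contains its opening job (mint_le_maxt), so that
   at most size s batches are opened and fuel size s suffices. *)
Fixpoint gac_batches (fuel c : nat) (s : seq 'I_n) : seq (seq 'I_n) :=
  if fuel is fuel'.+1 then
    if s is j0 :: _ then
      let: (t, u) := split_first (gac_compatible j0) c s in
      t :: gac_batches fuel' c u
    else [::]
  else [::].

Definition GACb (ord : {set 'I_n} -> seq 'I_n) (J : {set 'I_n}) (c : nat) : nat :=
  size (gac_batches (size (ord J)) c (ord J)).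

Definition bC (ord : {set 'I_n} -> seq 'I_n) (r : 'I_a) : nat :=
  GACb ord (small_jobs r) max_capacity.

Definition batches_lb (ord : {set 'I_n} -> seq 'I_n) (r : 'I_a) : nat :=
  #|large_jobs r| + maxn (bE r) (bC ord r).

Definition setup_costs (ord : {set 'I_n} -> seq 'I_n) : seq nat :=
  sort leq
    (flatten [seq nseq (batches_lb ord r) (min_cost_from r) | r <- enum 'I_a]
     ++ [seq min_cost_from (init_state O m) | m <- enum 'I_k]).

Lemma gac_order_exists : exists ord, gac_order ord.
Proof.
exists (fun J => sort (fun i j => mint O j <= mint O i) (unit_copies J)) => J.
split; first by rewrite perm_sort.
by apply: sort_sorted => i j; exact: leq_total.
Qed.

End OSP.

(* Main.v *)
Require Import Defs.
From mathcomp Require Import all_boot all_order all_algebra.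
From mathcomp Require Import zify.
Set Implicit Arguments.
Unset Strict Implicit.
Unset Printing Implicit Defensive.
Import Order.TTheory GRing.Theory Num.Theory.

(** Both bounds rest on [batches_lb r] being at most the number [N_r] of batches
    of attribute [r]. A large job fills a batch alone; the remaining batches of
    attribute [r] number at least [bE r] by counting capacity, and at least
    [bC r] because GAC+ is optimal for unit size jobs. For the latter, a
    batching is seen as a matching of the jobs into time slots, a batch
    processed in time [t] providing [c] slots [t], and the greedy batches are
    exchanged one after the other into that matching.

    The first bound then charges each batch the cheapest setup into its
    attribute. For the second, the attributes left by the setups of a machine
    are its initial state and the attributes of all its batches but the last.
    With [theta] the largest of the [b] smallest elements of [setup_costs],
    [\sum_(i < b) setup_costs(i) = b * theta - \sum_x (theta - x)], where [x]
    ranges over [setup_costs] and the subtraction is truncated; replacing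
    [batches_lb r] by [N_r] in this expression cannot decrease it. *)

Lemma rem_cat_notin (T : eqType) (x : T) s1 s2 :
  x \notin s1 -> rem x (s1 ++ s2) = s1 ++ rem x s2.
Proof.
by elim: s1 => //= y s1 IHs; rewrite inE negb_or eq_sym => /andP[/negPf-> /IHs->].
Qed.

Section Greedy.
Variables (R : realDomainType) (k n a q : nat) (O : osp_instance R k n a q).

Definition fits (j : 'I_n) (t : nat) : bool := mint O j <= t <= maxt O j.

Fixpoint matchable (s : seq 'I_n) (T : seq nat) : Prop :=
  if s is j :: s' then
    exists t, [/\ t \in T, fits j t & matchable s' (rem t T)]
  else True.

Lemma matchable_sub s T T' :
  (forall t, count_mem t T <= count_mem t T') ->
  matchable s T -> matchable s T'.
Proof.
elim: s T T' => //= j s IHs T T' leT [t [tT jt sT]]; exists t; split => //.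
  by rewrite -has_pred1 has_count (leq_trans _ (leT t)) // -has_count has_pred1.
by apply: IHs sT => u; rewrite !count_rem; move: (leT u) tT; rewrite -!has_pred1 !has_count /=;
  case: eqVneq => [->|]; lia.
Qed.

Lemma matchable_perm s T T' : perm_eq T T' -> matchable s T -> matchable s T'.
Proof. by move=> /permP eqT; apply: matchable_sub => t; rewrite eqT. Qed.

Lemma matchable_map (f : 'I_n -> nat) s :
  {in s, forall j, fits j (f j)} -> matchable s (map f s).
Proof.
elim: s => //= j s IHs fitf; exists (f j); rewrite inE !eqxx; split => //.
  by apply: fitf; rewrite mem_head.
by apply: IHs => i si; apply: fitf; rewrite inE si orbT.
Qed.

Lemma matchable_lower_slot s T t M :
  t <= M -> {in s, forall j, mint O j <= t} ->
  matchable s (M :: T) -> matchable s (t :: T).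
Proof.
move=> tM; elim: s T => //= j s IHs T jt [u [uT ju]].
have st : {in s, forall i, mint O i <= t}.
  by move=> i si; apply: jt; rewrite inE si orbT.
have [eMu sT | neMu /(IHs _ st) sT] := eqVneq M u.
  exists t; rewrite inE !eqxx; split => //.
  by move: ju; rewrite /fits -eMu jt ?mem_head //; lia.
move: uT; rewrite inE eq_sym (negPf neMu) /= => uT; exists u; rewrite inE uT orbT; split => //.
apply: matchable_perm sT; case: eqVneq => [->|//].
by rewrite perm_sym perm_to_rem.
Qed.

Lemma matchable_minn M s T :
  {in s, forall j, mint O j <= M} -> matchable s T ->
  matchable s (map (minn M) T).
Proof.
elim: s T => //= j s IHs T leM [t [tT jt sT]].
have sM : {in s, forall i, mint O i <= M}.
  by move=> i si; apply: leM; rewrite inE si orbT.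
exists (minn M t); split; first exact: map_f.
  by move: jt; rewrite /fits; have := leM j (mem_head _ _); lia.
apply: matchable_perm (IHs _ sM sT).
have /permP eqT := perm_map (minn M) (perm_to_rem tT).
apply/permP => p; rewrite count_rem map_f // eqT /=; lia.
Qed.

Local Notation mint_ge := (fun i j => mint O j <= mint O i).

Lemma subseq_split_first (p : pred 'I_n) c s : subseq (split_first p c s).2 s.
Proof.
elim: s c => //= x s IHs c; case: ifP => _.
  by have := IHs c.-1; case: split_first => u v /= vs; apply: subseq_trans vs (subseq_cons _ _).
by have := IHs c; case: split_first => u v /=; rewrite eqxx.
Qed.

Lemma mint_ge_trans : transitive mint_ge.
Proof. by move=> j i l ij jl; apply: leq_trans jl ij. Qed.

(* If the first job x is taken by the greedy batch but was matched to a slot t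
   of T, a job occupying a slot M of the batch may move to t: it fits there,
   because its mint is at most that of x and its maxt is at least M >= t. *)
Lemma matchable_split_first (p : pred 'I_n) M c s T :
  sorted mint_ge s -> {in s, forall j, mint O j <= M} ->
  {in s, forall j, p j = (M <= maxt O j)} -> {in T, forall t, t <= M} ->
  matchable s (nseq c M ++ T) -> matchable (split_first p c s).2 T.
Proof.
elim: s c T => //= x s IHs c T xs_sorted leM pE TM.
have s_sorted : sorted mint_ge s := path_sorted xs_sorted.
have sx : {in s, forall j, mint O j <= mint O x}.
  by apply/allP; apply: order_path_min xs_sorted; exact: mint_ge_trans.
have sM : {in s, forall i, mint O i <= M}.
  by move=> i si; apply: leM; rewrite inE si orbT.
have sp : {in s, forall j, p j = (M <= maxt O j)}.
  by move=> i si; apply: pE; rewrite inE si orbT.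
case=> t [tT xt sT].
have [/andP[px c_gt0] | npc] := boolP (p x && (0 < c)).
  suff : matchable (split_first p c.-1 s).2 T by case: split_first.
  apply: IHs => //; case: c c_gt0 tT sT => //= c _.
  rewrite inE; have [-> // | neM /=] := eqVneq M t.
  rewrite mem_cat mem_nseq eq_sym (negPf neM) andbF /= => tT.
  have t_notin : t \notin nseq c M by rewrite mem_nseq eq_sym (negPf neM) andbF.
  rewrite rem_cat_notin // => sT.
  have : matchable s (t :: nseq c M ++ rem t T).
    apply: matchable_lower_slot sT; first exact: TM.
    by move=> j sj; apply: leq_trans (sx j sj) _; case/andP: xt.
  apply: matchable_perm; rewrite -[t :: _]cat1s perm_catCA perm_cat2l perm_sym.
  exact: perm_to_rem.
have t_notin : t \notin nseq c M.
  move: npc; rewrite mem_nseq pE ?mem_head //; move: xt; rewrite /fits; lia.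
move: tT sT; rewrite mem_cat rem_cat_notin // (negPf t_notin) /= => tT sT.
have : matchable (split_first p c s).2 (rem t T).
  by apply: IHs => // u /mem_rem; exact: TM.
by case: split_first => u v /= vT; exists t.
Qed.

Lemma gac_batches_min fuel c s ts :
  sorted mint_ge s -> matchable s (flatten [seq nseq c t | t <- ts]) ->
  size (gac_batches O fuel c s) <= size ts.
Proof.
elim: fuel s ts => [|fuel IHf] [|j0 s] // ts s_sorted s_ts.
set M := mint O j0; set T := flatten _ in s_ts.
have leM : {in j0 :: s, forall j, mint O j <= M}.
  move=> j; rewrite inE => /predU1P[-> // | sj].
  by move/allP: (order_path_min mint_ge_trans s_sorted); apply.
case: (s_ts) => t [tT j0t _].
have tts : t \in ts.
  by move: tT => /flatten_mapP[u uts]; rewrite mem_nseq => /andP[_ /eqP->].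
have tM : minn M t = M by move: j0t; rewrite /fits /M; lia.
have /matchable_minn -/(_ _ leM) := s_ts => s_tsM.
pose ts' := map (minn M) (rem t ts).
have s_ts' : matchable (j0 :: s) (nseq c M ++ flatten [seq nseq c u | u <- ts']).
  have -> : nseq c M ++ flatten [seq nseq c u | u <- ts'] =
      [seq minn M u | u <- flatten [seq nseq c u | u <- t :: rem t ts]].
    rewrite map_flatten -map_comp /= map_nseq tM -map_comp.
    by congr (_ ++ flatten _); apply: eq_map => u /=; rewrite map_nseq.
  apply: matchable_perm s_tsM; apply/perm_map/perm_flatten/perm_map.
  exact: perm_to_rem.
have sizets' : size ts' = (size ts).-1 by rewrite size_map size_rem.
have ts_gt0 : 0 < size ts by case: (ts) tts.
have u_ts' := @matchable_split_first (gac_compatible O j0) M c (j0 :: s) _ s_sorted leM _ _ s_ts'.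
have u_sub := subseq_split_first (gac_compatible O j0) c (j0 :: s).
rewrite [gac_batches _ _ _ _](_ : _ =
  let: (B, u) := split_first (gac_compatible O j0) c (j0 :: s) in
  B :: gac_batches O fuel c u) //.
move: u_sub u_ts'; case: split_first => [B u] u_sub u_ts'.
rewrite /= -(prednK ts_gt0) ltnS -sizets'; apply: IHf.
  exact: (subseq_sorted mint_ge_trans u_sub) s_sorted.
apply: u_ts'.
  by move=> j sj; rewrite /gac_compatible leM.
move=> v /flatten_mapP[w /mapP[x _ ->]]; rewrite mem_nseq => /andP[_ /eqP->].
exact: geq_minl.
Qed.

End Greedy.

Section CapacityBound.
Local Open Scope ring_scope.

Lemma capacity_bound (I : finType) (c d x : I -> nat) (s C : nat)
    (ratio : I -> rat) :
  (forall i, ratio i = (d i)%:R / (c i)%:R) ->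
  (forall i, 0 < c i <= C)%N -> (forall i, d i <= x i * c i)%N ->
  (s + \sum_i d i <= \sum_i x i * c i)%N ->
  `|\sum_i Num.ceil (ratio i)
     + Num.ceil (Num.max 0 (s%:R - \sum_i ((Num.ceil (ratio i))%:~R - ratio i) * (c i)%:R)
                 / C%:R)| <= (\sum_i x i)%N%:Z.
Proof.
move=> ratioE cC dx sdx.
have c_gt0 i : 0 < (c i)%:R :> rat by rewrite ltr0n; case/andP: (cC i).
have ceil_ratio_le i : Num.ceil (ratio i) <= (x i)%:Z.
  by rewrite ratioE ceil_le_int ler_pdivrMr // -natrM ler_nat.
have ceil_ge0 (y : rat) : 0 <= y -> 0 <= Num.ceil y.
  by move=> y_ge0; rewrite ceil_ge0 (lt_le_trans _ y_ge0).
rewrite ger0_norm; last first.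
  apply: addr_ge0; first by apply: sumr_ge0 => i _; rewrite ratioE ceil_ge0 ?divr_ge0.
  by rewrite ceil_ge0 // divr_ge0 // le_max lexx.
pose slack i : rat := (x i)%:R - (Num.ceil (ratio i))%:~R.
have slack_ge0 i : 0 <= slack i.
  by rewrite subr_ge0 -[(x i)%:R]/((x i)%:Z%:~R) ler_int.
rewrite -lerBrDl ceil_le_int.
have -> : ((\sum_i x i)%N%:Z - \sum_i Num.ceil (ratio i))%:~R = \sum_i slack i.
  by rewrite rmorphB sumrB -natr_sum [X in _ - X]rmorph_sum.
have [-> | C_neq0] := eqVneq C 0.
  by rewrite invr0 mulr0 sumr_ge0.
rewrite ler_pdivrMr ?ltr0n ?lt0n // ge_max mulr_ge0 ?sumr_ge0 //=.
apply: (@le_trans _ _ (\sum_i slack i * (c i)%:R)); last first.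
  rewrite mulr_suml ler_sum // => i _; rewrite ler_wpM2l // ler_nat.
  by case/andP: (cC i).
rewrite lerBlDr -big_split /=.
under eq_bigr => i _ do rewrite -mulrDl addrA subrK mulrBl ratioE divfK ?gt_eqF //.
rewrite sumrB lerBrDr.
under [X in _ <= X]eq_bigr do rewrite -natrM.
by rewrite -!natr_sum -natrD ler_nat.
Qed.
End CapacityBound.

Lemma leq_bigminn (I : finType) (P : pred I) (F : I -> nat) x0 i :
  P i -> \big[minn/x0]_(j | P j) F j <= F i.
Proof. exact: (@bigmin_le_cond _ nat). Qed.

Lemma sum_prefix_sorted (L : seq nat) b : sorted leq L -> b <= size L ->
  exists theta, \sum_(i < b) nth 0 L i + \sum_(x <- L) (theta - x) <= b * theta.
Proof.
case: b => [|b] L_sorted bL; first by exists 0; rewrite big_ord0 big1.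
have mono i j : i <= j -> j < size L -> nth 0 L i <= nth 0 L j.
  by move=> ij jL; apply: sorted_leq_nth => //; [exact: leq_trans|rewrite inE; lia].
exists (nth 0 L b).
rewrite (big_nth 0) (big_cat_nat (leq0n b.+1) bL) /= [X in _ + (_ + X)]big_nat_cond.
rewrite [X in _ + (_ + X)]big1 => [|i /andP[/andP[bi iL] _]]; last first.
  by have := mono b i; lia.
rewrite addn0 big_mkord -big_split /= -[b.+1 in X in _ <= X]card_ord -sum_nat_const.
apply: leq_sum => i _; have := mono i b; have := ltn_ord i; lia.
Qed.

Section Batches.
Variables (R : realDomainType) (k n a q : nat) (O : osp_instance R k n a q).
Variables (S : schedule k n a) (hS : feasible O S).

Lemma leq_max_capacity m : capacity O m <= max_capacity O.
Proof. exact: leq_bigmax. Qed.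

Definition batch : finType := {m : 'I_k & 'I_(nbatch S m)}.
Definition attr_of (u : batch) : 'I_a := battr S (tag u) (tagged u).
Definition prev_of (u : batch) : 'I_a := prev_attr O S (tag u) (tagged u).
Definition jobs_of (u : batch) : {set 'I_n} := bjobs S (tag u) (tagged u).
Definition time_of (u : batch) : nat := ptime O S (tag u) (tagged u).
Definition attr_batches (r : 'I_a) : {set batch} := [set u | attr_of u == r].

Lemma exists_batch_of : exists f : 'I_n -> batch,
  forall j u, (j \in jobs_of u) = (f j == u).
Proof.
suff /fin_all_exists[f fP] : forall j, exists u0 : batch, forall u,
    (j \in jobs_of u) = (u0 == u) by exists f.
move=> j; have [[m b] [/= [bm jmb] uniq_mb]] := feas_partition hS j.
exists (Tagged (fun m => 'I_(nbatch S m)) (Ordinal bm)) => u.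
apply/idP/eqP => [ju | <- //].
have := uniq_mb (tag u, nat_of_ord (tagged u)) (conj (ltn_ord _) ju).
case: u ju => m' b' /= ju [em eb]; subst m'.
by congr existT; apply: val_inj.
Qed.

Lemma sum_batch (F : forall m, 'I_(nbatch S m) -> nat) :
  \sum_m \sum_(b < nbatch S m) F m b = \sum_(u : batch) F (tag u) (tagged u).
Proof. exact: (sig_big_dep (J := fun m => 'I_(nbatch S m)) xpredT (fun _ => xpredT)). Qed.

Lemma sum_attr_of (g : 'I_a -> nat) :
  \sum_(u : batch) g (attr_of u) = \sum_r #|attr_batches r| * g r.
Proof.
rewrite (partition_big attr_of xpredT) //=; apply: eq_bigr => r _.
rewrite (eq_bigr (fun=> g r)) => [|u /eqP-> //].
by rewrite sum_nat_const; congr (_ * _); apply: eq_card => u; rewrite inE.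
Qed.

Lemma total_setup_costE :
  total_setup_cost O S = \sum_(u : batch) setup_cost O (prev_of u) (attr_of u).
Proof.
rewrite -(sum_batch (fun m b => setup_cost O (prev_attr O S m b) (battr S m b))).
rewrite /total_setup_cost big_mkcond; apply: eq_bigr => m _.
by case: (nbatch S m) => [|N]; rewrite ?big_ord0 // big_ord_recl.
Qed.

Lemma sum_prev_of (g : 'I_a -> nat) :
  \sum_(u : batch) g (prev_of u)
    <= \sum_m g (init_state O m) + \sum_(u : batch) g (attr_of u).
Proof.
rewrite -(sum_batch (fun m b => g (prev_attr O S m b))).
rewrite -(sum_batch (fun m b => g (battr S m b))) -big_split /=.
apply: leq_sum => m _; case: (nbatch S m) => [|N]; first by rewrite big_ord0.
by rewrite big_ord_recl leq_add2l [leqRHS]big_ord_recr leq_addr.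
Qed.

Section BatchOf.
Variable f : 'I_n -> batch.
Hypothesis fP : forall j u, (j \in jobs_of u) = (f j == u).

Lemma mem_batch_of j : j \in jobs_of (f j).
Proof. by rewrite fP. Qed.

Lemma attr_batch_of j : attr_of (f j) = jattr O j.
Proof. by rewrite (feas_attr hS _ (mem_batch_of j)). Qed.

Lemma machine_batch_of j : tag (f j) \in eligible O j.
Proof. by apply: (feas_eligible hS) (mem_batch_of j). Qed.

Lemma fits_batch_of j : fits O j (time_of (f j)).
Proof.
rewrite /fits (feas_maxt hS _ (mem_batch_of j)) // andbT.
exact: leq_bigmax_cond (mem_batch_of j).
Qed.

Lemma sum_size_batch u (P : pred 'I_n) :
  \sum_(j | P j && (f j == u)) jsize O j <= capacity O (tag u).
Proof.
apply: leq_trans (feas_capacity hS (ltn_ord (tagged u))).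
rewrite -/(jobs_of u) big_mkcond [leqRHS]big_mkcond; apply: leq_sum => j _.
by rewrite fP; case: (P j); case: eqP.
Qed.

Lemma sum_size_batches (A : {set batch}) (P : pred 'I_n) :
  (forall j, P j -> f j \in A) ->
  \sum_(j | P j) jsize O j <= \sum_(u in A) capacity O (tag u).
Proof.
move=> PA; rewrite (partition_big f [in A]) //=.
by apply: leq_sum => u _; exact: sum_size_batch.
Qed.

Lemma large_job_alone r i j :
  j \in large_jobs O r -> f i = f j -> i = j.
Proof.
rewrite inE => /andP[_ large_j] fij; apply/eqP/negPn/negP => neq_ij.
have eq_attr : jattr O i == jattr O j by rewrite -!attr_batch_of fij.
have min_i : min_size_like O j <= jsize O i by exact: leq_bigminn.
have max_j : capacity O (tag (f j)) <= \max_(m in eligible O j) capacity O m.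
  exact: leq_bigmax_cond (machine_batch_of j).
have : jsize O i + jsize O j <= capacity O (tag (f j)).
  apply: leq_trans (sum_size_batch (f j) xpredT).
  rewrite (bigD1 i) /= ?fij // leq_add2l (bigD1 j) ?leq_addr //=.
  by rewrite eqxx eq_sym neq_ij.
by move: large_j min_i max_j; lia.
Qed.

Section Attribute.
Variable r : 'I_a.

Definition rest_batches : {set batch} :=
  attr_batches r :\: (f @: large_jobs O r).

Lemma card_rest_batches :
  #|large_jobs O r| + #|rest_batches| = #|attr_batches r|.
Proof.
rewrite -[RHS](cardsID (f @: large_jobs O r)) (setIidPr _).
  by rewrite card_in_imset // => i j _ jl /(large_job_alone jl).
apply/subsetP => _ /imsetP[j jl ->]; rewrite inE attr_batch_of.
by move: jl; rewrite inE => /andP[].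
Qed.

Lemma batch_of_small j : j \in small_jobs O r -> f j \in rest_batches.
Proof.
rewrite !inE attr_batch_of => /andP[j_small ->]; rewrite andbT.
apply/negP => /imsetP[i il /(large_job_alone il) eji].
by move: il j_small; rewrite eji inE => ->.
Qed.

Lemma bE_le_card : bE O r <= #|rest_batches|.
Proof.
pose x m := \sum_(u in rest_batches | tag u == m) 1.
have sum_x : \sum_m x m = #|rest_batches|.
  by rewrite -sum1_card (partition_big (fun u : batch => tag u) xpredT).
rewrite -sum_x; apply: (@capacity_bound _ (capacity O)
  (fun i => \sum_(j in small_jobs O r | eligible O j == [set i]) jsize O j)) => //.
- by move=> m; rewrite capacity_gt0 leq_max_capacity.
- move=> m; rewrite big_distrl /=.
  pose A := [set u in rest_batches | tag u == m].
  apply: leq_trans (@sum_size_batches A _ _) _ => [j /andP[jr /eqP jm]|].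
    by rewrite inE batch_of_small //= -in_set1 -jm machine_batch_of.
  rewrite (eq_bigl (fun u => (u \in rest_batches) && (tag u == m))).
    by apply: leq_sum => u /andP[_ /eqP->]; rewrite mul1n.
  by move=> u; rewrite inE.
- have -> : \sum_m x m * capacity O m = \sum_(u in rest_batches) capacity O (tag u).
    rewrite [RHS](partition_big (fun u : batch => tag u) xpredT) //=.
    apply: eq_bigr => m _; rewrite big_distrl /=.
    by apply: eq_bigr => u /andP[_ /eqP->]; rewrite mul1n.
  apply: leq_trans (sum_size_batches batch_of_small).
  rewrite (exchange_big_dep [in small_jobs O r]) /=; last by move=> i j _ /andP[].
  rewrite /bE_shared big_mkcondr -big_split /=; apply: leq_sum => j jr.
  have [m /eqP jm | no_m] := pickP (fun m => eligible O j == [set m]).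
    rewrite jm cards1 add0n (eq_bigl (pred1 m)) ?big_pred1_eq // => i.
    by rewrite jr /= (inj_eq set1_inj) eq_sym.
  by rewrite big_pred0 ?addn0 => [|i]; [case: ifP | rewrite no_m andbF].
Qed.

Lemma bC_le_card ord : gac_order O ord -> bC O ord r <= #|rest_batches|.
Proof.
move=> ord_gac; have [ord_perm ord_sorted] := ord_gac (small_jobs O r).
have mem_ord j : j \in ord (small_jobs O r) -> j \in small_jobs O r.
  rewrite (perm_mem ord_perm) => /flatten_mapP[i].
  by rewrite mem_enum mem_nseq => ir /andP[_ /eqP->].
rewrite cardE -(size_map time_of); apply: gac_batches_min => //.
apply: matchable_sub (matchable_map (f := time_of \o f) _); last first.
  by move=> j _; exact: fits_batch_of.
move=> t; rewrite count_map (permP ord_perm) !count_flatten !sumnE !big_map.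
rewrite !big_enum /= (partition_big f [in rest_batches] batch_of_small) /=.
apply: leq_sum => u _; rewrite count_nseq /=.
have [tu | ntu] := eqVneq (time_of u) t.
  rewrite mul1n; apply: leq_trans (leq_max_capacity (tag u)).
  apply: leq_trans (sum_size_batch u [in small_jobs O r]).
  by apply: leq_sum => j _; rewrite count_nseq /=; case: eqP; rewrite ?mul1n.
by rewrite big1 // => j /andP[_ /eqP fj]; rewrite count_nseq /= fj (negPf ntu).
Qed.

Lemma batches_lb_le_card ord :
  gac_order O ord -> batches_lb O ord r <= #|attr_batches r|.
Proof.
by move=> ord_gac; rewrite -card_rest_batches leq_add2l geq_max bE_le_card bC_le_card.
Qed.

End Attribute.
End BatchOf.
End Batches.

Lemma sum_setup_costs (R : realDomainType) k n a q
    (O : osp_instance R k n a q) ord (g : nat -> nat) :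
  \sum_(x <- setup_costs O ord) g x =
    \sum_r batches_lb O ord r * g (min_cost_from O r)
    + \sum_m g (min_cost_from O (init_state O m)).
Proof.
rewrite (perm_big _ (permEl (perm_sort _ _))) big_cat big_flatten !big_map -!enumT !big_enum /=.
by congr (_ + _); apply: eq_bigr => r _; rewrite big_nseq iter_addn_0 mulnC.
Qed.

Theorem mainTheorem4 (R : realDomainType) (k n a q : nat)
    (O : osp_instance R k n a q)
    (ord : {set 'I_n} -> seq 'I_n) (hord : gac_order O ord)
    (S : schedule k n a) (hS : feasible O S) :
  maxn (\sum_(r < a) batches_lb O ord r * min_cost_to O r)
       (\sum_(i < \sum_(r < a) batches_lb O ord r) nth 0 (setup_costs O ord) i)
  <= total_setup_cost O S.
Proof.
have [f fP] := exists_batch_of hS.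
have lb_card r : batches_lb O ord r <= #|attr_batches S r|.
  exact: (batches_lb_le_card hS fP).
rewrite total_setup_costE geq_max; apply/andP; split.
  apply: leq_trans (_ : \sum_(u : batch S) min_cost_to O (attr_of u) <= _).
    by rewrite sum_attr_of; apply: leq_sum => r _; rewrite leq_mul2r lb_card orbT.
  by apply: leq_sum => u _; exact: leq_bigminn.
set b := \sum_(r < a) _.
have b_size : b <= size (setup_costs O ord).
  rewrite -sum1_size sum_setup_costs -[leqLHS]addn0 leq_add //.
  by apply: leq_sum => r _; rewrite muln1.
have [theta] := sum_prefix_sorted (sort_sorted leq_total _ : sorted leq (setup_costs O ord)) b_size.
rewrite sum_setup_costs.
pose g r := theta - min_cost_from O r.
have := sum_prev_of O S g; rewrite sum_attr_of.
have : \sum_r #|attr_batches S r| * g r + b * theta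
    <= \sum_r batches_lb O ord r * g r + \sum_r #|attr_batches S r| * theta.
  rewrite big_distrl -!big_split /=; apply: leq_sum => r _.
  rewrite -(subnK (lb_card r)) !mulnDl [leqRHS]addnCA -!addnA leq_add2r.
  by rewrite leq_mul2l leq_subr orbT.
have : \sum_r #|attr_batches S r| * theta
    <= \sum_(u : batch S) setup_cost O (prev_of O u) (attr_of u)
       + \sum_(u : batch S) g (prev_of O u).
  rewrite -(sum_attr_of S (fun=> theta)) -big_split /=; apply: leq_sum => u _.
  have : min_cost_from O (prev_of O u) <= setup_cost O (prev_of O u) (attr_of u).
    exact: leq_bigminn.
  rewrite /g; lia.
rewrite /g; lia.
Qed.
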